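(* Let $1<p,q<\infty$ with $\frac1p+\frac1q=1$, let $M$ be a nonempty subset of $\mathbb{N}$ with complement $\bar{M}=\mathbb{N}\setminus M$, and let $r>0$. The Mordukhovich derivatives of the metric projection $P_{r\mathbb{C}_M}\colon l_p\to r\mathbb{C}_M$ onto the cylinder $r\mathbb{C}_M=\{x\in l_p:\|x_M\|_p\le r\}$ have the following representations. (i) For every $\bar{x}\in(r\mathbb{C}_M)^\circ$ (the interior), $\widehat{D}^*P_{r\mathbb{C}_M}(\bar{x})(y^* )=\{y^*\}$ for every $y^*\in l_q$. (ii) For every $\bar{x}\in l_p\setminus r\mathbb{C}_M$, $$\widehat{D}^*P_{r\mathbb{C}_M}(\bar{x})(y^* )=\left\{\frac{r}{\|\bar{x}_M\|_p}\left(y_M^*-\frac{\langle y_M^*,\bar{x}_M\rangle}{\|\bar{x}_M\|_p^2}J(\bar{x}_M)\right)+y_{\bar{M}}^*\right\}\quad\text{for all } y^*\in l_q.$$ In particular, $\widehat{D}^*P_{r\mathbb{C}_M}(\bar{x})(J(\bar{x}))=\{(J(\bar{x}))_{\bar{M}}\}$ for every $\bar{x}\in l_p\setminus r\mathbb{C}_M$. (iii) For any $\bar{x}\in\partial(r\mathbb{C}_M)=\{x\in l_p:\|x_M\|_p=r\}$: (a) $\widehat{D}^*P_{r\mathbb{C}_M}(\bar{x})(\theta^* )=\{\theta^*\}$; (b) for any $y^*\in l_q$, $$\theta^*\in\widehat{D}^*P_{r\mathbb{C}_M}(\bar{x})(y^* )\iff y_{\bar{M}}^*=\theta^*,\ -(J^*(y^*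 ))_M\notin\bar{x}_r^{\Downarrow}\ \text{ and }\ \langle y_M^*,\bar{x}_M\rangle=-r\|y_M^*\|_q.$$ In particular, $\theta^*\in\widehat{D}^*P_{r\mathbb{C}_M}(\bar{x})(-(J(\bar{x}))_M)$; (c) $\widehat{D}^*P_{r\mathbb{C}_M}(\bar{x})(J(\bar{x}))=\emptyset$.
   Context: $(l_p,\|\cdot\|_p)$ is the real sequence space, with dual $(l_q,\|\cdot\|_q)$ and the usual pairing $\langle\cdot,\cdot\rangle$ between $l_q$ and $l_p$; $\theta=\theta^*=(0,0,\dots)$. $\mathbb{N}$ is the set of positive integers. $J\colon l_p\to l_q$ is the normalized duality mapping: $J(\theta)=\theta^*$ and, for $x\ne\theta$, $J(x)_i=|x_i|^{p-1}\operatorname{sign}(x_i)/\|x\|_p^{p-2}$. Likewise $J^*\colon l_q\to l_p$ is the normalized duality mapping of $l_q$: $J^*(\theta^* )=\theta$ and, for $y^*=(y_1,y_2,\dots)\neq\theta^*$, $J^*(y^* )_i=|y_i|^{q-1}\operatorname{sign}(y_i)/\|y^*\|_q^{q-2}$. For $A\subseteq\mathbb{N}$ (here $A=M$ or $A=\bar{M}$) and $x$ in $l_p$ or $l_q$, $x_A$ is the sequence with $(x_A)_i=x_i$ for $i\in A$ and $(x_A)_i=0$ for $i\notin A$; thus $x=x_M+x_{\bar{M}}$. For a nonempty closed convex $C\subseteq l_p$, $P_C(x)$ is the unique point of $C$ nearest to $x$. The Mordukhovich derivative (Fréchet coderivative) of $P_C$ at $\bar{x}\in l_p$ is defined for $y^*\in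 l_q$ by $$\widehat{D}^*P_C(\bar{x})(y^* )=\left\{x^*\in l_q:\limsup_{u\to\bar{x}}\frac{\langle x^*,u-\bar{x}\rangle-\langle y^*,P_C(u)-P_C(\bar{x})\rangle}{\|u-\bar{x}\|_p+\|P_C(u)-P_C(\bar{x})\|_p}\le 0\right\}.$$ For $x\in l_p$ with $\|x_M\|_p=r$: $x_r^{\Downarrow}=\{v\in l_p:\text{there is }\delta>0\text{ such that }\|(x+tv)_M\|_p\le r\text{ for all }t\in(0,\delta)\}$.
   Formalization: In (iii)(b) the equivalence is stated only for y* ≠ θ*: at y* = θ* it is false, since θ* lies in the derivative at θ* by (a), while −(J*(θ* ))_M = θ always belongs to the set x_r^⇓. *)

(* Defs.v *)
From HB Require Import structures.
From mathcomp Require Import all_boot all_order all_algebra.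
From mathcomp Require Import all_classical all_reals all_analysis.

Set Implicit Arguments.
Unset Strict Implicit.
Unset Printing Implicit Defensive.
Import Order.TTheory GRing.Theory Num.Def Num.Theory.
Import numFieldNormedType.Exports.
Local Open Scope classical_set_scope.
Local Open Scope ring_scope.

(* A real sequence (x_1, x_2, ...) is a function x on nat with x_i = x i.-1;
   sets of positive integers are shifted in the same way. *)

Section lp_space.
Context {R : realType}.

Lemma lee1_EFin (p : R) : 1 < p -> (1 <= p%:E)%E.
Proof. by move=> p1; rewrite lee_fin ltW. Qed.

Definition lp (p : R) (p1 : 1 < p) :=
  @LfunType _ nat R counting p%:E (lee1_EFin p1).

Variables (p : R) (p1 : 1 < p).

HB.instance Definition _ := GRing.Lmodule.on (lp p1).

Lemma lpP (x y : lp p1) : x = y <-> x =1 y.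
Proof. exact: LfuneqP. Qed.

Definition lp_norm (x : lp p1) : R := fine ('N[counting]_p%:E[EFin \o x])%E.

Lemma lp_normD (x y : lp p1) : lp_norm (x + y) <= lp_norm x + lp_norm y.
Proof. exact: ler_LnormD. Qed.

Lemma lp_normZ (a : R) (x : lp p1) : lp_norm (a *: x) = `|a| * lp_norm x.
Proof. by rewrite /lp_norm (LnormZ x a) fineM// -finite_norm_fine. Qed.

Lemma lp_norm0_eq0 (x : lp p1) : lp_norm x = 0 -> x = 0.
Proof.
move=> x0; apply/lpP => k.
have p0 : 0 < p := lt_trans ltr01 p1.
have : ('N[counting]_p%:E[EFin \o x] = 0)%E.
  by rewrite -(finite_norm_fine x) -/(lp_norm x) x0.
rewrite Lnorm_counting// => /poweR_eq0_eq0 s0.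
have ge0 n : (0 <= `|(EFin \o x) n| `^ p)%E by exact: poweR_ge0.
have := s0 (nneseries_ge0 (fun n _ _ => ge0 n)).
rewrite (nneseriesD1 (n := k))// => /eqP.
rewrite padde_eq0//; last by apply: nneseries_ge0.
move=> /andP[/eqP /poweR_eq0_eq0 xk _].
have /eqP := xk (abse_ge0 _).
by rewrite abse_eq0 eqe => /eqP.
Qed.

HB.instance Definition _ :=
  Lmodule_isNormed.Build R (lp p1) lp_normD lp_normZ lp_norm0_eq0.

Lemma lp_normE (x : lp p1) :
  `|x| = fine (\sum_(k <oo) (`|x k| `^ p)%:E)%E `^ p^-1.
Proof.
have p0 : 0 < p := lt_trans ltr01 p1.
by rewrite [LHS]/(lp_norm x) /lp_norm Lnorm_counting// fine_poweR.
Qed.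

Lemma summable_Lfun (f : nat -> R) :
  (\sum_(k <oo) (`|f k| `^ p)%:E < +oo)%E -> f \in Lfun counting p%:E.
Proof.
move=> sf; have p0 : 0 < p := lt_trans ltr01 p1.
rewrite inE; apply/andP; split; rewrite inE//=.
by rewrite /finite_norm Lnorm_counting//; exact: poweR_lty.
Qed.

Lemma Lfun_summable (x : lp p1) : (\sum_(k <oo) (`|x k| `^ p)%:E < +oo)%E.
Proof.
have p0 : 0 < p := lt_trans ltr01 p1.
have : finite_norm counting p%:E x by exact: Lfunction_finite.
by rewrite /finite_norm Lnorm_counting// => /lty_poweRy; apply; rewrite invr_neq0 ?gt_eqF.
Qed.

Definition lp_mk (f : nat -> R)
    (sf : (\sum_(k <oo) (`|f k| `^ p)%:E < +oo)%E) : lp p1 :=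
  Lfun_Sub (lee1_EFin p1) (summable_Lfun sf).

Lemma restr_summable (A : set nat) (x : lp p1) :
  (\sum_(k <oo) (`|if k \in A then x k else 0| `^ p)%:E < +oo)%E.
Proof.
apply: le_lt_trans (Lfun_summable x); apply: lee_nneseries => k _.
  by rewrite lee_fin powR_ge0.
case: ifP => // _; rewrite lee_fin normr0 powR0 ?powR_ge0//.
by rewrite gt_eqF// (lt_trans _ p1).
Qed.

Definition restr (A : set nat) (x : lp p1) : lp p1 :=
  lp_mk (restr_summable A x).

Lemma restrE A x k : restr A x k = if k \in A then x k else 0.
Proof. by []. Qed.

End lp_space.

Section duality.
Context {R : realType}.

Lemma conjugate_sym (p q : R) : p^-1 + q^-1 = 1 -> q^-1 + p^-1 = 1.
Proof. by rewrite addrC. Qed.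

Definition pairing (p q : R) (p1 : 1 < p) (q1 : 1 < q)
    (y : lp q1) (x : lp p1) : R :=
  limn (series (fun k => y k * x k)).

Definition duality_seq (p : R) (p1 : 1 < p) (x : lp p1) (k : nat) : R :=
  if x == 0 then 0 else `|x k| `^ (p - 1) * sgr (x k) / `|x| `^ (p - 2).

Lemma duality_summable (p q : R) (p1 : 1 < p) (q1 : 1 < q)
    (pq : p^-1 + q^-1 = 1) (x : lp p1) :
  (\sum_(k <oo) (`|duality_seq x k| `^ q)%:E < +oo)%E.
Proof.
have p0 : 0 < p := lt_trans ltr01 p1.
have q0 : 0 < q := lt_trans ltr01 q1.
have pq1 : (p - 1) * q = p.
  have /(congr1 (fun t => t * (p * q))) := pq.
  rewrite mul1r mulrDl mulKf ?gt_eqF// mulrCA mulVf ?gt_eqF// mulr1 => h.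
  by rewrite mulrBl mul1r -h addrC addKr.
rewrite /duality_seq; case: eqP => [_|x0].
  rewrite eseries0// => k _ _.
  by rewrite normr0 powR0// gt_eqF.
set c := (`|x| `^ (p - 2)) ^-1.
have c0 : 0 <= c by rewrite invr_ge0 powR_ge0.
apply: (@le_lt_trans _ _ (\sum_(k <oo) (c `^ q)%:E * (`|x k| `^ p)%:E)%E).
  apply: lee_nneseries => k _; first by rewrite lee_fin powR_ge0.
  rewrite -EFinM lee_fin !normrM (ger0_norm c0) mulrC.
  rewrite powRM ?mulr_ge0// ler_wpM2l ?powR_ge0//.
  rewrite ger0_norm ?powR_ge0//.
  have -> : `|x k| `^ p = (`|x k| `^ (p - 1)) `^ q by rewrite -powRrM pq1.
  apply: ge0_ler_powR; rewrite ?nnegrE ?mulr_ge0 ?powR_ge0 ?(ltW q0)//.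
  by rewrite ler_piMr ?powR_ge0// normr_sg; case: (_ != _).
rewrite nneseriesZl; last by move=> k _; rewrite lee_fin powR_ge0.
by apply: lte_mul_pinfty; rewrite ?lee_fin ?powR_ge0//; exact: Lfun_summable.
Qed.

Definition duality_map (p q : R) (p1 : 1 < p) (q1 : 1 < q)
    (pq : p^-1 + q^-1 = 1) (x : lp p1) : lp q1 :=
  lp_mk q1 (duality_summable q1 pq x).

End duality.

Definition boundary (T : topologicalType) (C : set T) : set T :=
  closure C `\` C°.

(* The default value x is never used when C is a nonempty closed convex subset
   of lp, where the nearest point exists and is unique. *)
Definition metric_proj (R : realType) (V : normedModType R) (C : set V)
    (x : V) : V :=
  xget x [set y | C y /\ forall z, C z -> `|x - y| <= `|x - z|].

Definition frechet_coderivative (R : realType) (p q : R) (p1 : 1 < p)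
    (q1 : 1 < q) (f : lp p1 -> lp p1) (x : lp p1) (y : lp q1) : set (lp q1) :=
  [set z | (limf_esup (fun u =>
     ((pairing z (u - x) - pairing y (f u - f x)) /
      (`|u - x| + `|f u - f x|))%:E) x^' <= 0)%E].

Section cylinder.
Context {R : realType} {p : R} {p1 : 1 < p}.
Implicit Types (M : set nat) (r : R).

Definition cylinder M r : set (lp p1) := [set x | `|restr M x| <= r].

(* As 0 lies in this set whenever `|restr M x| = r, a hypothesis of the form
   ~ down_directions M r x (- restr M v) forces restr M v to be nonzero. *)
Definition down_directions M r (x : lp p1) : set (lp p1) :=
  [set v | exists2 d : R, 0 < d &
     forall t : R, 0 < t < d -> `|restr M (x + t *: v)| <= r].

End cylinder.

(* Main.v *)
(* Outside the cylinder the projection is the radial map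
   u |-> u_{M^c} + (r / |u_M|) u_M: equality in Young's inequality, applied
   termwise to <mazur a, u - y> with a = u - radial u, gives both minimality and
   uniqueness.  The norm of lp is Frechet differentiable away from 0 because
   |x + h| - |x| - <J x / |x|, h> lies between 0 and
   <J (x + h) / |x + h| - J x / |x|, h>, and J is continuous.  In (i) and (ii)
   the projection is Frechet differentiable, and the coderivative of a
   differentiable map is the adjoint of its derivative.

   On the boundary it suffices to test the coderivative along rays x + t v.
   Rays staying in C give <z, w - x> <= <y, w - x> for w in C, so that 0 belongs
   to D x y iff y attains its minimum over C at x, which is the equality case of
   Hoelder's inequality; the down-direction condition follows from it.  In (c)
   the rays v = x_M, v = - x_M give <z, x_M> <= 0 < <J x, x_M> <= <z, x_M>. *)
Require Import Defs.
From HB Require Import structures.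
From mathcomp Require Import all_boot all_order all_algebra.
From mathcomp Require Import all_classical all_reals all_analysis.
From mathcomp Require Import ring lra.

Set Implicit Arguments.
Unset Strict Implicit.
Unset Printing Implicit Defensive.
Import Order.TTheory GRing.Theory Num.Def Num.Theory.
Import numFieldNormedType.Exports.
Local Open Scope classical_set_scope.
Local Open Scope ring_scope.

(** * Signed powers on the line and the strict Young inequality *)

Section signed_power.
Context {R : realType}.

(** The tangent to exp at [a * u] lies strictly below exp at [u] and at 0; weighting the two
    inequalities by [a] and [b] cancels the linear terms. *)
Lemma expR_lt_convex (a b u : R) : 0 < a -> 0 < b -> a + b = 1 -> u != 0 ->
  expR (a * u) < a * expR u + b.
Proof.
move=> a0 b0 ab u0.
have E0 : 0 < expR (a * u) by exact: expR_gt0.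
have h1 : expR (a * u) * (1 + b * u) < expR u.
  have -> : expR u = expR (a * u) * expR (b * u).
    by rewrite -expRD -mulrDl ab mul1r.
  by rewrite ltr_pM2l// expR_gt1Dx// mulf_neq0// gt_eqF.
have h2 : expR (a * u) * (1 - a * u) < 1.
  rewrite -[ltRHS]expR0 -[in ltRHS](subrr (a * u)) expRD ltr_pM2l//.
  by rewrite expR_gt1Dx// oppr_eq0 mulf_neq0// gt_eqF.
rewrite -(ltr_pM2l a0) in h1; rewrite -(ltr_pM2l b0) in h2.
have := ltrD h1 h2; rewrite mulr1; apply: le_lt_trans.
have -> : b = 1 - a by lra.
lra.
Qed.

(** For s = p - 1 this is the derivative of |a|^p / p, that is, one coordinate of the duality map
    without its norm factor. *)
Definition spow (s a : R) := `|a| `^ s * sgr a.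

Lemma spow0 s : spow s 0 = 0.
Proof. by rewrite /spow sgr0 mulr0. Qed.

Lemma spowM s a b : spow s (a * b) = spow s a * spow s b.
Proof. by rewrite /spow normrM powRM// sgrM mulrACA. Qed.

Lemma norm_spow s a : 0 < s -> `|spow s a| = `|a| `^ s.
Proof.
move=> s0; have [->|a0] := eqVneq a 0.
  by rewrite spow0 normr0 powR0// gt_eqF.
by rewrite /spow normrM normr_sg a0 mulr1 ger0_norm// powR_ge0.
Qed.

Lemma conjugate_mulB1 (p q : R) : 1 < p -> 1 < q -> p^-1 + q^-1 = 1 ->
  (p - 1) * q = p.
Proof.
move=> p1 q1 /(congr1 (fun t => t * (p * q))).
have p0 : p != 0 by rewrite gt_eqF// (lt_trans _ p1).
have q0 : q != 0 by rewrite gt_eqF// (lt_trans _ q1).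
rewrite mul1r mulrDl mulKf// mulrCA mulVf// mulr1 => h.
by rewrite mulrBl mul1r -h addrC addKr.
Qed.

Variables (p q : R) (p1 : 1 < p) (q1 : 1 < q) (pq : p^-1 + q^-1 = 1).
Let p0 : 0 < p. Proof. exact: lt_trans p1. Qed.
Let q0 : 0 < q. Proof. exact: lt_trans q1. Qed.
Let pB0 : 0 < p - 1. Proof. by rewrite subr_gt0. Qed.

Lemma spow_mul a : spow (p - 1) a * a = `|a| `^ p.
Proof.
by rewrite /spow -mulrA -normrEsg mulrC mulr_powRB1.
Qed.

Lemma norm_spow_powR a : `|spow (p - 1) a| `^ q = `|a| `^ p.
Proof. by rewrite norm_spow// -powRrM conjugate_mulB1. Qed.

(** For t > 0 this is strict convexity of exp at u = p ln t, with weights 1/p and 1/q. *)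
Lemma lt_young1 (t : R) : t != 1 -> t < `|t| `^ p / p + q^-1.
Proof.
move=> t1; have [t0|t0] := leP t 0.
  by rewrite (le_lt_trans t0)// ltr_wpDl ?invr_gt0// divr_ge0 ?powR_ge0// ltW.
have u0 : p * ln t != 0 by rewrite mulf_eq0 negb_or ln_eq0// t1 gt_eqF.
have := expR_lt_convex (a := p^-1) (b := q^-1) _ _ pq u0.
rewrite !invr_gt0 => /(_ p0 q0); rewrite mulKf ?gt_eqF// lnK//.
by rewrite gtr0_norm// [p^-1 * _]mulrC /powR gt_eqF.
Qed.

(** Dividing by |a|^p leaves the one-variable case t = b / a. Strictness off the diagonal is what
    later gives uniqueness of the nearest point. *)
Lemma lt_young_spow (a b : R) : a != b ->
  spow (p - 1) a * b < `|a| `^ p / q + `|b| `^ p / p.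
Proof.
move=> ab; have [a0|a0] := eqVneq a 0.
  rewrite a0 spow0 mul0r normr0 powR0 ?gt_eqF// mul0r add0r.
  by rewrite divr_gt0// powR_gt0// normr_gt0 -a0 eq_sym.
have -> : b = a * (b / a) by rewrite mulrC divfK.
rewrite mulrA spow_mul normrM powRM// -mulrA -mulrDr ltr_pM2l.
  rewrite addrC lt_young1//; apply: contra ab => /eqP/(congr1 ( *%R^~ a)).
  by rewrite divfK// mul1r => ->.
by rewrite powR_gt0// normr_gt0.
Qed.

Lemma young_spow (a b : R) :
  spow (p - 1) a * b <= `|a| `^ p / q + `|b| `^ p / p.
Proof.
have [->|ab] := eqVneq a b; last exact/ltW/lt_young_spow.
by rewrite spow_mul -mulrDr addrC pq mulr1.
Qed.

Lemma young_mul (a b : R) : `|a * b| <= `|a| `^ q / q + `|b| `^ p / p.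
Proof. by rewrite normrM addrC mulrC conjugate_powR. Qed.

Lemma cvg_spow1 s : spow s t @[t --> (1 : R)] --> (1 : R).
Proof.
have : {for (1 : R), continuous (fun t : R => t `^ s)}.
  apply: differentiable_continuous; apply/derivable1_diffP.
  by apply: derivable_powR; rewrite in_itv/= ltr01.
rewrite /prop_for /continuous_at powR1.
apply: cvg_trans; apply: near_eq_cvg; near=> t.
have t0 : 0 < t by near: t; exact: lt_nbhsr.
by rewrite /spow gtr0_norm// gtr0_sg// mulr1.
Unshelve. all: by end_near. Qed.

(* By homogeneity in (a, b) it is enough to consider a = 1: close to 1 the
   first term wins, away from 1 the second one. *)
Lemma spow_sub_le (e : R) : 0 < e -> exists2 C, 0 < C & forall a b,
  `|spow (p - 1) a - spow (p - 1) b| `^ q <=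
    e * `|a| `^ p + C * `|b - a| `^ p.
Proof.
move=> e0.
have e'0 : 0 < e `^ q^-1 by rewrite powR_gt0.
have /cvgrPdist_lt/(_ _ e'0)[d /= d0 near1] := @cvg_spow1 (p - 1).
(* Chosen so that |1 - s| >= d implies both 1 <= K |s - 1| and |s| <= K |s - 1|. *)
pose K := 1 + d^-1.
have K0 : 0 < K by rewrite addr_gt0// invr_gt0.
(* The summand 1 serves a = 0; the other one is (2 (K |s - 1|)^(p-1))^q divided by |s - 1|^p. *)
exists (1 + 2 `^ q * K `^ p) => [|a b].
  by rewrite ltr_pwDl// mulr_ge0// powR_ge0.
have C1 : 1 <= 1 + 2 `^ q * K `^ p by rewrite lerDl mulr_ge0// powR_ge0.
have [->|a0] := eqVneq a 0.
  rewrite spow0 sub0r subr0 normrN norm_spow_powR normr0 powR0 ?gt_eqF//.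
  by rewrite mulr0 add0r ler_peMl// powR_ge0.
have [s ->] : exists s, b = a * s by exists (b / a); rewrite mulrC divfK.
have -> : spow (p - 1) a - spow (p - 1) (a * s) =
  spow (p - 1) a * (1 - spow (p - 1) s) by rewrite spowM; ring.
have -> : a * s - a = a * (s - 1) by ring.
rewrite (normrM (spow _ a)) (normrM a).
rewrite !powRM// norm_spow_powR.
rewrite (mulrC e) (mulrCA (1 + _)) -mulrDr.
apply: ler_wpM2l; first exact: powR_ge0.
have [sd|sd] := ltP `|1 - s| d.
  apply: (@le_trans _ _ e); last first.
    by rewrite lerDl mulr_ge0 ?powR_ge0// (le_trans _ C1).
  have -> : e = (e `^ q^-1) `^ q.
    by rewrite -powRrM mulVf ?gt_eqF// powRr1// ltW.
  by rewrite ge0_ler_powR ?nnegrE ?(ltW q0)// ltW// near1.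
have s1 : 1 <= K * `|s - 1|.
  rewrite mulrDl mul1r ler_wpDl// mulrC ler_pdivlMr// mul1r.
  by rewrite distrC.
have sK : `|s| <= K * `|s - 1|.
  rewrite mulrDl mul1r -{1}(subrK 1 s) (le_trans (ler_normD _ _))//.
  by rewrite lerD2l normr1 mulrC ler_pdivlMr// mul1r distrC.
apply: (@le_trans _ _ ((2 * (K * `|s - 1|) `^ (p - 1)) `^ q)).
  rewrite ge0_ler_powR ?nnegrE ?(ltW q0)// ?mulr_ge0 ?powR_ge0//.
  rewrite (le_trans (ler_normB _ _))// normr1 norm_spow// mulr_natl mulr2n.
  rewrite lerD//; last first.
    by rewrite ge0_ler_powR ?nnegrE ?(ltW pB0)// mulr_ge0// ltW.
  apply: (@le_trans _ _ (1 `^ (p - 1))); first by rewrite powR1.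
  by rewrite ge0_ler_powR ?nnegrE ?(ltW pB0)// mulr_ge0// ltW.
rewrite powRM ?powR_ge0// -powRrM conjugate_mulB1// powRM ?(ltW K0)//.
by rewrite mulrA mulrDl mul1r ler_wpDl ?(ltW e0)// lerDr powR_ge0.
Qed.

End signed_power.

(** * Real series, norms and coordinate restrictions in l_p *)

Section lp_theory.
Context {R : realType}.

Lemma term_le_series (u : nat -> R) k : (forall k, 0 <= u k) ->
  cvgn (series u) -> u k <= limn (series u).
Proof.
move=> u0 cu; apply: le_trans (nondecreasing_cvgn_le _ cu k.+1).
  by rewrite seriesEnat/= big_nat_recr//= lerDr sumr_ge0.
exact: nondecreasing_series.
Qed.

Lemma is_cvg_series_comb (a b : R) (u v : nat -> R) :
  cvgn (series u) -> cvgn (series v) ->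
  cvgn (series (fun k => u k * a + v k * b)).
Proof.
move=> cu cv.
rewrite (_ : (fun k => _) = a *: u + b *: v); last first.
  by apply/funext => k; congr (_ + _); exact: mulrC.
by apply: is_cvg_seriesD; exact: is_cvg_seriesZ.
Qed.

Lemma lim_series_comb (a b : R) (u v : nat -> R) :
  cvgn (series u) -> cvgn (series v) ->
  limn (series (fun k => u k * a + v k * b)) =
  limn (series u) * a + limn (series v) * b.
Proof.
move=> cu cv.
rewrite (_ : (fun k => _) = a *: u + b *: v); last first.
  by apply/funext => k; congr (_ + _); exact: mulrC.
rewrite lim_seriesD; [|exact: is_cvg_seriesZ..].
by rewrite !lim_seriesZ//; congr (_ + _); exact: mulrC.
Qed.

Section one_exponent.
Variables (p : R) (p1 : 1 < p).
Let p0 : 0 < p. Proof. exact: lt_trans p1. Qed.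
Implicit Types (x y : lp p1) (A : set nat).

Lemma is_cvg_series_powR x : cvgn (series (fun k => `|x k| `^ p)).
Proof.
by apply: nnseries_is_cvg (Lfun_summable x) => k; exact: powR_ge0.
Qed.

(** Replaces the extended-real sum by a limit of real partial sums, so that norm estimates can be
    proved termwise. *)
Lemma lp_norm_powR x : `|x| `^ p = limn (series (fun k => `|x k| `^ p)).
Proof.
rewrite lp_normE -powRrM mulVf ?gt_eqF// powRr1; last first.
  by apply/fine_ge0/nneseries_ge0 => k _ _; rewrite lee_fin powR_ge0.
rewrite -[RHS]/(fine _%:E) -EFin_lim; last exact: is_cvg_series_powR.
congr (fine (lim (_ @ \oo))); apply/funext => n.
by rewrite sumEFin.
Qed.

Lemma lpDE x y k : (x + y) k = x k + y k. Proof. by []. Qed.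

Lemma lpZE (a : R) x k : (a *: x) k = a * x k. Proof. by []. Qed.

Lemma lpNE x k : (- x) k = - x k. Proof. by []. Qed.

Lemma lp_norm_le_powR x (c : R) : 0 <= c -> `|x| `^ p <= c `^ p -> `|x| <= c.
Proof.
move=> c0; apply: contra_le => cx.
by rewrite gt0_ltr_powR ?nnegrE.
Qed.

Lemma restrD A x y : restr A (x + y) = restr A x + restr A y.
Proof.
by apply/lpP => k; rewrite !(restrE, lpDE); case: ifP => //; rewrite addr0.
Qed.

Lemma restrZ A (a : R) x : restr A (a *: x) = a *: restr A x.
Proof.
by apply/lpP => k; rewrite !(restrE, lpZE); case: ifP => //; rewrite mulr0.
Qed.

Lemma restrN A x : restr A (- x) = - restr A x.
Proof. by rewrite -scaleN1r restrZ scaleN1r. Qed.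

Lemma restrB A x y : restr A (x - y) = restr A x - restr A y.
Proof. by rewrite restrD restrN. Qed.

Lemma restr_id A x : restr A (restr A x) = restr A x.
Proof. by apply/lpP => k; rewrite !restrE; case: (k \in A). Qed.

Lemma restrCr A x : restr A (restr (~` A) x) = 0.
Proof.
apply/lpP => k; rewrite !restrE; case: ifP => // kA.
by rewrite in_setC kA.
Qed.

Lemma restrCl A x : restr (~` A) (restr A x) = 0.
Proof.
apply/lpP => k; rewrite !restrE in_setC; case: ifP => //.
by move=> /negPf ->.
Qed.

Lemma restr0 A : restr A (0 : lp p1) = 0.
Proof. by apply/lpP => k; rewrite restrE; case: ifP. Qed.

Lemma restr_split A x : x = restr A x + restr (~` A) x.
Proof.
apply/lpP => k; rewrite lpDE !restrE in_setC.
by case: ifP; rewrite ?addr0 ?add0r.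
Qed.

Lemma norm_restr_le A x : `|restr A x| <= `|x|.
Proof.
apply: lp_norm_le_powR => //; rewrite !lp_norm_powR.
apply: lim_series_le => [||k]; try exact: is_cvg_series_powR.
rewrite restrE; case: ifP => // _; rewrite normr0 powR0 ?powR_ge0//.
by rewrite gt_eqF.
Qed.

End one_exponent.

Arguments is_cvg_series_powR {p p1} x.

(** * The pairing, Hoelder's inequality and the duality map *)

Section two_exponents.
Variables (p q : R) (p1 : 1 < p) (q1 : 1 < q) (pq : p^-1 + q^-1 = 1).
Let p0 : 0 < p. Proof. exact: lt_trans p1. Qed.
Let q0 : 0 < q. Proof. exact: lt_trans q1. Qed.
Implicit Types (x : lp p1) (y : lp q1).

Lemma is_cvg_normed_pairing y x : cvgn [normed series (fun k => y k * x k)].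
Proof.
apply: (@series_le_cvg _ _ (fun k => `|y k| `^ q / q + `|x k| `^ p / p)).
- by move=> k /=.
- by move=> k; rewrite addr_ge0// divr_ge0 ?powR_ge0// ltW.
- by move=> k; exact: young_mul.
- by apply: is_cvg_series_comb; exact: is_cvg_series_powR.
Qed.

Lemma is_cvg_pairing y x : cvgn (series (fun k => y k * x k)).
Proof. exact/normed_cvg/is_cvg_normed_pairing. Qed.

Lemma pairingDl y y' x : pairing (y + y') x = pairing y x + pairing y' x.
Proof.
rewrite /pairing -lim_seriesD; [|exact: is_cvg_pairing..].
by congr (limn (series _)); apply/funext => k; rewrite /= mulrDl.
Qed.

Lemma pairingZl (a : R) y x : pairing (a *: y) x = a * pairing y x.
Proof.
rewrite /pairing -[RHS]/(a *: _) -lim_seriesZ; last exact: is_cvg_pairing.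
by congr (limn (series _)); apply/funext => k; rewrite lpZE -mulrA.
Qed.

Lemma pairingDr y x x' : pairing y (x + x') = pairing y x + pairing y x'.
Proof.
rewrite /pairing -lim_seriesD; [|exact: is_cvg_pairing..].
by congr (limn (series _)); apply/funext => k; rewrite /= mulrDr.
Qed.

Lemma pairingZr (a : R) y x : pairing y (a *: x) = a * pairing y x.
Proof.
rewrite /pairing -[RHS]/(a *: _) -lim_seriesZ; last exact: is_cvg_pairing.
by congr (limn (series _)); apply/funext => k; rewrite /= mulrCA.
Qed.

Lemma pairingNl y x : pairing (- y) x = - pairing y x.
Proof. by rewrite -scaleN1r pairingZl mulN1r. Qed.

Lemma pairingNr y x : pairing y (- x) = - pairing y x.
Proof. by rewrite -scaleN1r pairingZr mulN1r. Qed.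

Lemma pairingBl y y' x : pairing (y - y') x = pairing y x - pairing y' x.
Proof. by rewrite pairingDl pairingNl. Qed.

Lemma pairingBr y x x' : pairing y (x - x') = pairing y x - pairing y x'.
Proof. by rewrite pairingDr pairingNr. Qed.

Lemma pairing0l x : pairing (0 : lp q1) x = 0.
Proof. by rewrite -(subrr (0 : lp q1)) pairingBl subrr. Qed.

Lemma pairing0r y : pairing y (0 : lp p1) = 0.
Proof. by rewrite -(subrr (0 : lp p1)) pairingBr subrr. Qed.

Lemma pairing_restr A y x : pairing (restr A y) x = pairing y (restr A x).
Proof.
rewrite /pairing; congr (limn (series _)); apply/funext => k.
by rewrite !restrE; case: ifP => _; rewrite ?mul0r ?mulr0.
Qed.

Lemma pairing_young y x : pairing y x <= `|y| `^ q / q + `|x| `^ p / p.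
Proof.
have cy := is_cvg_series_powR y; have cx := is_cvg_series_powR x.
rewrite !lp_norm_powR -(@lim_series_comb q^-1 p^-1 _ _ cy cx).
apply: lim_series_le => [||k]; first exact: is_cvg_pairing.
  exact: (@is_cvg_series_comb q^-1 p^-1 _ _ cy cx).
by rewrite (le_trans (ler_norm _))// young_mul.
Qed.

(** Hoelder: after scaling both vectors to norm 1, the bound in Young's inequality is 1/q + 1/p =
    1. *)
Lemma pairing_le y x : pairing y x <= `|y| * `|x|.
Proof.
have [->|y0] := eqVneq y 0; first by rewrite pairing0l normr0 mul0r.
have [->|x0] := eqVneq x 0.
  by rewrite pairing0r normr0 mulr0.
have Ny : 0 < `|y| by rewrite normr_gt0.
have Nx : 0 < `|x| by rewrite normr_gt0.
have := pairing_young (`|y|^-1 *: y) (`|x|^-1 *: x).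
rewrite pairingZl pairingZr !normrZ !normfV !normr_id !mulVf ?gt_eqF//.
rewrite !powR1 !mul1r addrC pq mulrA -invfM mulrC ler_pdivrMr ?mulr_gt0//.
by rewrite mul1r mulrC.
Qed.

Lemma mazur_summable x :
  (\sum_(k <oo) (`|spow (p - 1) (x k)| `^ q)%:E < +oo)%E.
Proof.
rewrite (eq_eseriesr (g := fun k => (`|x k| `^ p)%:E)); last first.
  by move=> k _; rewrite norm_spow_powR.
exact: Lfun_summable.
Qed.

(** The Mazur map, which is the duality map without its norm factor: it acts coordinatewise and has
    no special case at 0. *)
Definition mazur x : lp q1 := lp_mk q1 (mazur_summable x).

Lemma mazurE x k : mazur x k = spow (p - 1) (x k).
Proof. by []. Qed.

Lemma mazur0 : mazur 0 = 0.
Proof. by apply/lpP => k; rewrite mazurE spow0. Qed.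

Lemma mazurZ (a : R) x : mazur (a *: x) = spow (p - 1) a *: mazur x.
Proof. by apply/lpP => k; rewrite lpZE !mazurE spowM. Qed.

Lemma mazur_restr A x : mazur (restr A x) = restr A (mazur x).
Proof.
apply/lpP => k; rewrite mazurE !restrE mazurE.
by case: ifP => // _; rewrite spow0.
Qed.

Lemma norm_mazur_powR x : `|mazur x| `^ q = `|x| `^ p.
Proof.
rewrite !lp_norm_powR; congr (limn (series _)); apply/funext => k.
by rewrite norm_spow_powR.
Qed.

Lemma norm_mazur x : `|mazur x| = `|x| `^ (p - 1).
Proof.
apply: (powR_injective q0); rewrite ?nnegrE ?powR_ge0//.
by rewrite norm_mazur_powR -powRrM conjugate_mulB1.
Qed.

Lemma pairing_mazur x : pairing (mazur x) x = `|x| `^ p.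
Proof.
rewrite lp_norm_powR; congr (limn (series _)); apply/funext => k.
by rewrite mazurE spow_mul.
Qed.

(* The terms of the Young gap between mazur x and x' are nonnegative and sum
   up to at most 0. *)
Lemma pairing_mazur_eq x x' : `|x'| <= `|x| ->
  `|x| `^ p <= pairing (mazur x) x' -> x' = x.
Proof.
move=> x'x mx.
pose f k := `|x k| `^ p / q + `|x' k| `^ p / p.
have cx := is_cvg_series_powR x; have cx' := is_cvg_series_powR x'.
have cf : cvgn (series f).
  exact: (@is_cvg_series_comb q^-1 p^-1 _ _ cx cx').
pose g := f - (fun k => mazur x k * x' k).
have g0 k : 0 <= g k by rewrite subr_ge0 young_spow.
have cg : cvgn (series g) by apply: is_cvg_seriesB => //; exact: is_cvg_pairing.
have lg : limn (series g) <= 0.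
  rewrite lim_seriesB ?subr_le0//; last exact: is_cvg_pairing.
  rewrite (@lim_series_comb q^-1 p^-1 _ _ cx cx') -!lp_norm_powR.
  rewrite (le_trans _ mx)//.
  rewrite -[leRHS]mulr1 -pq [in leRHS]addrC mulrDr lerD2l ler_wpM2r//.
    by rewrite invr_ge0 ltW.
  by rewrite ge0_ler_powR ?nnegrE// ltW.
apply/lpP => k; apply/eqP; apply: contraT => xk.
have : g k <= 0 by rewrite (le_trans (term_le_series _ g0 cg)).
rewrite leNgt subr_gt0 lt_young_spow//.
by rewrite eq_sym.
Qed.

(** Summing [spow_sub_le] over the coordinates bounds the q-th power of the distance by e1 |x|^p + C
    |u - x|^p; [e1] and [d] hold each term to half of e^q. *)
Lemma mazur_continuous x e : 0 < e ->
  exists2 d, 0 < d & forall u, `|u - x| < d -> `|mazur u - mazur x| < e.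
Proof.
move=> e0.
have eq0 : 0 < e `^ q by rewrite powR_gt0.
have px0 : 0 < `|x| `^ p + 1 by rewrite ltr_wpDl// powR_ge0.
pose e1 := e `^ q / 2 / (`|x| `^ p + 1).
have e10 : 0 < e1 by rewrite !divr_gt0.
have [C C0 mC] := spow_sub_le p1 q1 pq e10.
pose d := (e `^ q / 2 / C) `^ p^-1.
have d0 : 0 < d by rewrite powR_gt0// !divr_gt0.
exists d => // u xu; rewrite distrC.
suff : `|mazur x - mazur u| `^ q < e `^ q.
  rewrite !ltNge; apply: contra => h.
  by rewrite ge0_ler_powR ?nnegrE ?(ltW q0) ?(ltW e0).
apply: (@le_lt_trans _ _ (e1 * `|x| `^ p + C * `|u - x| `^ p)).
  have cx := is_cvg_series_powR x; have cux := is_cvg_series_powR (u - x).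
  rewrite !lp_norm_powR [e1 * _]mulrC [C * _]mulrC.
  rewrite -(@lim_series_comb e1 C _ _ cx cux).
  apply: lim_series_le => [||k]; first exact: is_cvg_series_powR.
    exact: (@is_cvg_series_comb e1 C _ _ cx cux).
  by rewrite [_ * e1]mulrC [_ * C]mulrC mC.
rewrite [ltRHS]splitr ltr_leD//.
  by rewrite /e1 mulrAC ltr_pdivrMr// ltr_pM2l ?divr_gt0// ltrDl.
rewrite mulrC -ler_pdivlMr//.
have -> : e `^ q / 2 / C = d `^ p.
  by rewrite -powRrM mulVf ?gt_eqF// powRr1// ltW// !divr_gt0.
by rewrite ge0_ler_powR ?nnegrE ?(ltW p0) ?(ltW d0) ?(ltW xu).
Qed.

Lemma duality_mapE x :
  duality_map q1 pq x = (`|x| `^ (p - 2))^-1 *: mazur x.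
Proof.
apply/lpP => k; rewrite lpZE mazurE.
change (duality_seq x k = (`|x| `^ (p - 2))^-1 * spow (p - 1) (x k)).
rewrite /duality_seq; case: eqP => [->|_].
  by rewrite spow0 mulr0.
by rewrite mulrC.
Qed.

Lemma norm_duality_map x : `|duality_map q1 pq x| = `|x|.
Proof.
have [->|x0] := eqVneq x 0.
  by rewrite duality_mapE mazur0 scaler0 !normr0.
have Nx : 0 < `|x| by rewrite normr_gt0.
rewrite duality_mapE normrZ norm_mazur gtr0_norm ?invr_gt0 ?powR_gt0//.
rewrite mulrC -powRB ?(gt_eqF Nx) ?implybT//.
by rewrite (_ : p - 1 - (p - 2) = 1) ?powRr1//; ring.
Qed.

Lemma pairing_duality_map x : pairing (duality_map q1 pq x) x = `|x| ^+ 2.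
Proof.
have [->|x0] := eqVneq x 0.
  by rewrite duality_mapE mazur0 scaler0 pairing0l normr0 expr0n.
have Nx : 0 < `|x| by rewrite normr_gt0.
rewrite duality_mapE pairingZl pairing_mazur.
rewrite mulrC -powRB ?(gt_eqF Nx) ?implybT// -powR_mulrn//.
by rewrite (_ : p - (p - 2) = 2) //; ring.
Qed.

Lemma restr_duality_map A x :
  restr A (duality_map q1 pq (restr A x)) = duality_map q1 pq (restr A x).
Proof. by rewrite !duality_mapE restrZ -mazur_restr restr_id. Qed.

End two_exponents.
End lp_theory.

(** * Limsup and nearest points in a normed space *)

Section normed_module.
Context {R : realType} {V : normedModType R}.
Implicit Types (x u : V) (A : set V).

Lemma nbhs_distP x A :
  nbhs x A <-> exists2 d : R, 0 < d & forall u, `|u - x| < d -> A u.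
Proof.
rewrite nbhs_ballP; split => -[d /= d0 dA]; exists d => // u.
  by move=> ux; apply: dA; rewrite -ball_normE /= distrC.
by rewrite -ball_normE /= distrC; exact: dA.
Qed.

(** The limsup is the infimum, over punctured neighbourhoods, of the suprema of g. *)
Lemma limf_esup_dnbhs_le0 (g : V -> R) x :
  (limf_esup (fun u => (g u)%:E) x^' <= 0)%E <->
  forall e, 0 < e -> exists2 d, 0 < d &
    forall u, u != x -> `|u - x| < d -> g u <= e.
Proof.
rewrite limf_esupE; split => [g0 e e0|g0].
  have : (ereal_inf [set ereal_sup ((fun u => (g u)%:E) @` A) | A in x^']
          < e%:E)%E.
    by rewrite (le_lt_trans g0)// lte_fin.
  case/ereal_inf_lt => _ [A xA <-] Ae.
  have /nbhs_distP[d d0 dA] : nbhs x (fun u => u != x -> A u) by exact: xA.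
  exists d => // u ux uxd; rewrite -lee_fin (le_trans _ (ltW Ae))//.
  by apply: ereal_sup_ubound; exists u => //; exact: dA.
apply/lee_addgt0Pr => e e0; rewrite add0e.
have [d d0 dg] := g0 e e0.
pose A := [set u | u != x /\ `|u - x| < d].
apply: (@le_trans _ _ (ereal_sup ((fun u => (g u)%:E) @` A))).
  apply: ereal_inf_lbound; exists A => //.
  have : nbhs x (fun u => u != x -> A u) by apply/nbhs_distP; exists d.
  by [].
by apply: ge_ereal_sup => _ [u [ux uxd] <-]; rewrite lee_fin dg.
Qed.

Lemma metric_proj_id (C : set V) x : C x -> metric_proj C x = x.
Proof.
move=> Cx; apply: xget_unique => [|y [_ /(_ _ Cx)]].
  by split=> // z _; rewrite subrr normr0.
by rewrite subrr normr0 normr_le0 subr_eq0 => /eqP.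
Qed.

End normed_module.

(** * General rules for the coderivative *)

Section coderivative.
Context {R : realType}.
Variables (p q : R) (p1 : 1 < p) (q1 : 1 < q) (pq : p^-1 + q^-1 = 1).
Implicit Types (f : lp p1 -> lp p1) (x u v : lp p1) (y z : lp q1).

Lemma pairingC x y : pairing x y = pairing y x.
Proof.
by rewrite /pairing; congr (limn (series _)); apply/funext => k; rewrite mulrC.
Qed.

(** The test vector v = J* z gives |z|^2 <= 0. *)
Lemma pairing_le0_eq0 z : (forall v, pairing z v <= 0) -> z = 0.
Proof.
move=> /(_ (duality_map p1 (conjugate_sym pq) z)).
rewrite -pairingC pairing_duality_map// => z0; apply/eqP.
by rewrite -normr_eq0 -sqrf_eq0 eq_le z0 sqr_ge0.
Qed.

(** The denominator is positive for u <> x and can be cleared; u = x may then be included, since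
    both sides vanish there. *)
Lemma frechet_coderivativeP f x y z :
  frechet_coderivative f x y z <->
  forall e, 0 < e -> exists2 d, 0 < d & forall u, `|u - x| < d ->
    pairing z (u - x) - pairing y (f u - f x) <=
    e * (`|u - x| + `|f u - f x|).
Proof.
rewrite /frechet_coderivative /= limf_esup_dnbhs_le0.
split => Dz e /Dz[d d0 Dd]; exists d => // u.
  have [->|ux] := eqVneq u x.
    by rewrite !subrr normr0 addr0 mulr0 !(pairing0r p1 pq) subrr.
  by move=> /(Dd _ ux); rewrite ler_pdivrMr// ltr_wpDr// normr_gt0 subr_eq0.
by move=> ux /Dd; rewrite ler_pdivrMr// ltr_wpDr// normr_gt0 subr_eq0.
Qed.

(** Divide by t along u = x + t v. The bound t K on the increment of f keeps the denominator of
    order t, so its contribution disappears as e tends to 0. *)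
Lemma frechet_coderivative_ray f x y z v (c K : R) :
  frechet_coderivative f x y z ->
  (forall e, 0 < e -> exists2 d, 0 < d & forall t, 0 < t < d ->
     pairing y (f (x + t *: v) - f x) <= t * (c + e) /\
     `|f (x + t *: v) - f x| <= t * K) ->
  pairing z v <= c.
Proof.
move=> /frechet_coderivativeP Dz fv; apply/ler_addgt0Pr => e e0.
have e20 : 0 < e / 2 by rewrite divr_gt0.
have [d1 d10 {}fv] := fv _ e20.
(* Dividing e / 2 by this sum makes the error term at most t e / 2. *)
have vK0 : 0 < `|v| + `|K| + 1 by rewrite ltr_wpDl// addr_ge0.
have [d2 d20 {}Dz] := Dz _ (divr_gt0 e20 vK0).
have v1 : 0 < `|v| + 1 by rewrite ltr_wpDl.
pose t := Num.min (d1 / 2) (d2 / (`|v| + 1)).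
have t0 : 0 < t by rewrite lt_min !divr_gt0.
have td1 : 0 < t < d1.
  rewrite t0 /= gt_min; apply/orP; left.
  by rewrite ltr_pdivrMr// ltr_pMr// ltr1n.
have [fy fK] := fv _ td1.
have tv : `|x + t *: v - x| < d2.
  rewrite addrAC subrr add0r normrZ gtr0_norm//.
  apply: (@lt_le_trans _ _ (t * (`|v| + 1))); first by rewrite ltr_pM2l// ltrDl.
  by rewrite -ler_pdivlMr// ge_min lexx orbT.
have := Dz _ tv.
have -> : x + t *: v - x = t *: v by rewrite addrAC subrr add0r.
rewrite (pairingZr pq) normrZ (gtr0_norm t0) => {}Dz.
rewrite -(ler_pM2l t0).
have h : e / 2 / (`|v| + `|K| + 1) * (t * `|v| + `|f (x + t *: v) - f x|) <=
    t * (e / 2).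
  rewrite mulrAC ler_pdivrMr//.
  rewrite (_ : t * _ * _ = e / 2 * (t * (`|v| + `|K| + 1))); last by ring.
  rewrite ler_pM2l//.
  by move: t0 fK (ler_wpM2l (ltW t0) (ler_norm K)); lra.
move: Dz h fy; lra.
Qed.

(** Rays give <w - z, v> <= 0 for every v and every w in the coderivative, hence w = z. Conversely z
    belongs to it because the numerator is minus the pairing of y with the differentiation
    remainder. *)
Lemma frechet_coderivative_differentiable f x (A : lp p1 -> lp p1) y z :
  (forall (t : R) v, A (t *: v) = t *: A v) ->
  (forall e, 0 < e -> exists2 d, 0 < d & forall h, `|h| < d ->
     `|f (x + h) - f x - A h| <= e * `|h|) ->
  (forall h, pairing y (A h) = pairing z h) ->
  frechet_coderivative f x y = [set z].
Proof.
move=> AZ df adj; apply/seteqP; split => [w Dw|_ ->] /=.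
  apply/eqP; rewrite -subr_eq0; apply/eqP/pairing_le0_eq0 => v.
  rewrite (pairingBl pq) subr_le0 -adj.
  apply: (frechet_coderivative_ray (K := `|A v| + 1)) Dw _ => e e0.
  have yv0 : 0 < (`|y| + 1) * (`|v| + 1) by rewrite mulr_gt0// ltr_wpDl.
  have v1 : 0 < `|v| + 1 by rewrite ltr_wpDl.
  (* The first bound makes |y| times the remainder at most t e; the second makes the remainder at
     most t, whence K = |A v| + 1. *)
  pose e' := Num.min (e / ((`|y| + 1) * (`|v| + 1))) (`|v| + 1)^-1.
  have e'0 : 0 < e' by rewrite lt_min divr_gt0// invr_gt0.
  have [d d0 {}df] := df _ e'0.
  exists (d / (`|v| + 1)); first by rewrite divr_gt0.
  move=> t /andP[t0 td].
  have tv : `|t *: v| < d.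
    rewrite normrZ gtr0_norm// (@lt_trans _ _ (t * (`|v| + 1)))//.
      by rewrite ltr_pM2l// ltrDl.
    by rewrite -ltr_pdivlMr.
  have := df _ tv; rewrite AZ normrZ gtr0_norm//.
  set b := f (x + t *: v) - f x => bA.
  have bA1 : `|b - t *: A v| <= t * 1.
    rewrite (le_trans bA)// mulrCA ler_pM2l//.
    rewrite (@le_trans _ _ ((`|v| + 1)^-1 * (`|v| + 1)))//.
      by rewrite ler_pM ?(ltW e'0) ?ge_min ?lexx ?orbT ?lerDl.
    by rewrite mulVf ?gt_eqF.
  have bA2 : `|y| * `|b - t *: A v| <= t * e.
    rewrite (@le_trans _ _ ((`|y| + 1) * (t * (e' * (`|v| + 1)))))//.
      apply: ler_pM => //; first by rewrite lerDl.
      rewrite (le_trans bA)// mulrCA ler_pM2l// ler_pM2l// lerDl//.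
    rewrite mulrCA ler_pM2l// mulrCA -ler_pdivlMr// ?ge_min ?lexx//.
  split.
    rewrite -(subrK (t *: A v) b) (pairingDr pq) (pairingZr pq) mulrDr addrC.
    by rewrite lerD2l (le_trans (pairing_le pq _ _)).
  rewrite -(subrK (t *: A v) b) (le_trans (ler_normD _ _))// normrZ gtr0_norm//.
  by rewrite mulrDr addrC lerD2l.
apply/frechet_coderivativeP => e e0.
have y1 : 0 < `|y| + 1 by rewrite ltr_wpDl.
have [d d0 {}df] := df _ (divr_gt0 e0 y1); exists d => // u /df.
rewrite (addrC x (u - x)) subrK => fu.
rewrite -adj -(pairingBr pq) (le_trans (pairing_le pq _ _))// distrC.
apply: (@le_trans _ _ (e * `|u - x|)); last by rewrite ler_pM2l// lerDl.
apply: (@le_trans _ _ ((`|y| + 1) * (e / (`|y| + 1) * `|u - x|))).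
  by apply: ler_pM => //; rewrite lerDl.
by rewrite mulrA mulrCA mulfV ?gt_eqF// mulr1.
Qed.

End coderivative.

(** * Frechet differentiability of the norm away from 0 *)

Section norm_derivative.
Context {R : realType}.
Variables (p q : R) (p1 : 1 < p) (q1 : 1 < q) (pq : p^-1 + q^-1 = 1).
Local Notation J := (duality_map q1 pq : lp p1 -> lp q1).

(** Rewrites the unit functional so that its denominator is the norm of [mazur x]. *)
Lemma duality_mapZ_mazur (x : lp p1) : x != 0 ->
  `|x|^-1 *: J x = (`|x| `^ (p - 1))^-1 *: mazur q1 pq x.
Proof.
move=> x0; have Nx : 0 < `|x| by rewrite normr_gt0.
rewrite duality_mapE scalerA -invfM -[in X in (X * _)^-1](powRr1 (ltW Nx)).
rewrite -powRD ?(gt_eqF Nx) ?implybT//.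
by rewrite (_ : 1 + (p - 2) = p - 1)//; ring.
Qed.

(* The difference of the unit functionals J u / |u| and J x / |x|, multiplied
   by |x|^(p-1), is mazur u - mazur x up to a multiple
   |mazur x| - |mazur u| of the first one. *)
Lemma duality_map_continuous (x : lp p1) e : x != 0 -> 0 < e ->
  exists2 d, 0 < d & forall u, `|u - x| < d ->
    `| `|u|^-1 *: J u - `|x|^-1 *: J x| <= e.
Proof.
move=> x0 e0; have Nx : 0 < `|x| by rewrite normr_gt0.
have Npx : 0 < `|x| `^ (p - 1) by rewrite powR_gt0.
have e'0 : 0 < e * `|x| `^ (p - 1) / 2 by rewrite divr_gt0// mulr_gt0.
have [d d0 xd] := mazur_continuous q1 pq x e'0.
(* The bound |u - x| < |x| keeps u away from 0. *)
exists (Num.min d `|x|); first by rewrite lt_min d0.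
move=> u; rewrite lt_min => /andP[ud ux].
have u0 : u != 0.
  by apply: contraTneq ux => ->; rewrite sub0r normrN ltxx.
have Npu : 0 < `|u| `^ (p - 1) by rewrite powR_gt0// normr_gt0.
rewrite !duality_mapZ_mazur//.
set a := `|x| `^ (p - 1) in Npx e'0 xd *; set b := `|u| `^ (p - 1) in Npu *.
have -> : b^-1 *: mazur q1 pq u - a^-1 *: mazur q1 pq x =
  a^-1 *: (mazur q1 pq u - mazur q1 pq x + ((a - b) / b) *: mazur q1 pq u).
  apply/lpP => k; rewrite !(lpDE, lpNE, lpZE).
  move: (mazur q1 pq u k) (mazur q1 pq x k) => m1 m2.
  by field; rewrite !gt_eqF.
rewrite normrZ gtr0_norm ?invr_gt0// mulrC ler_pdivrMr//.
rewrite (le_trans (ler_normD _ _))// normrZ norm_mazur -/b.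
rewrite normrM (gtr0_norm (_ : 0 < b^-1)) ?invr_gt0// divfK ?gt_eqF//.
have : `|a - b| <= `|mazur q1 pq u - mazur q1 pq x|.
  by rewrite distrC /a /b -!(norm_mazur q1 pq) ler_dist_dist.
by have := xd _ ud; lra.
Qed.

(* By duality the error lies between 0 and <J u / |u| - J x / |x|, h> with
   u = x + h. *)
Lemma lp_norm_differentiable (x : lp p1) e : x != 0 -> 0 < e ->
  exists2 d, 0 < d & forall h, `|h| < d ->
    `| `|x + h| - `|x| - `|x|^-1 * pairing (J x) h| <= e * `|h|.
Proof.
move=> x0 e0.
have [d d0 xd] := duality_map_continuous x0 e0.
exists d => // h hd.
(* J u / |u| is the supporting functional of the norm at u. With 0^-1 = 0 this and the next fact
   also cover u = 0. *)
have supp (u v : lp p1) : `|u|^-1 * pairing (J u) v <= `|v|.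
  have [->|u0] := eqVneq u 0; first by rewrite normr0 invr0 mul0r.
  rewrite mulrC ler_pdivrMr ?normr_gt0//.
  by rewrite (le_trans (pairing_le pq _ _))// norm_duality_map mulrC.
have suppid (u : lp p1) : `|u|^-1 * pairing (J u) u = `|u|.
  have [->|u0] := eqVneq u 0; first by rewrite normr0 invr0 mul0r.
  by rewrite pairing_duality_map expr2 mulKf// normr_eq0.
have := xd (x + h); rewrite [x + h - x]addrAC subrr add0r => /(_ hd) xdh.
have : pairing (`|x + h|^-1 *: J (x + h) - `|x|^-1 *: J x) h <= e * `|h|.
  by rewrite (le_trans (pairing_le pq _ _))// ler_wpM2r.
rewrite (pairingBl pq) !(pairingZl pq).
have := supp x (x + h); rewrite (pairingDr pq) mulrDr suppid.
have := supp (x + h) x; have := suppid (x + h).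
rewrite (pairingDr pq) mulrDr => h1 h2 h3 h4.
rewrite ger0_norm; last by rewrite -addrA -opprD subr_ge0.
rewrite (le_trans _ h4)// lerD2r lerBlDl -[leLHS]h1 lerD2r//.
Qed.

End norm_derivative.

(** * Geometry of the cylinder and the formula for its projection *)

Section cylinder_projection.
Context {R : realType}.
Variables (p q : R) (p1 : 1 < p) (q1 : 1 < q) (pq : p^-1 + q^-1 = 1).
Variables (M : set nat) (r : R) (r0 : 0 < r).
Local Notation J := (duality_map q1 pq : lp p1 -> lp q1).
Local Notation C := (cylinder M r : set (lp p1)).
Local Notation P := (metric_proj C).
Implicit Types x u v h : lp p1.

Lemma norm_restr_dist x u : `| `|restr M u| - `|restr M x| | <= `|u - x|.
Proof.
by rewrite (le_trans (ler_dist_dist _ _))// -restrB norm_restr_le.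
Qed.

(** If |x_M| >= r > 0, a slight outward scaling of x leaves the cylinder. Conversely u |-> |u_M| is
    1-Lipschitz. *)
Lemma interior_cylinderP x : C° x <-> `|restr M x| < r.
Proof.
split => [/nbhs_distP[d d0 dC]|xr].
  rewrite ltNge; apply/negP => rx.
  have x1 : 0 < `|x| + 1 by rewrite ltr_wpDl.
  have s0 : 0 < d / (`|x| + 1) by rewrite divr_gt0.
  have : C (x + (d / (`|x| + 1)) *: x).
    apply: dC; rewrite addrAC subrr add0r normrZ gtr0_norm//.
    by rewrite mulrAC ltr_pdivrMr// ltr_pM2l// ltrDl.
  rewrite /cylinder /= -[X in X + _]scale1r -scalerDl restrZ normrZ.
  rewrite gtr0_norm; last by rewrite ltr_pwDl// ltW.
  rewrite leNgt => /negP; apply; rewrite (le_lt_trans rx)//.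
  by rewrite ltr_pMl ?ltrDl// (lt_le_trans r0).
suff : nbhs x C by [].
apply/nbhs_distP; exists (r - `|restr M x|); first by rewrite subr_gt0.
move=> u ux; rewrite /cylinder /=.
by have := norm_restr_dist x u; rewrite ler_norml => /andP[_]; lra.
Qed.

Lemma closure_cylinder : closure C = C.
Proof.
apply/seteqP; split; last exact: subset_closure.
move=> x Cx; rewrite /cylinder /= leNgt; apply/negP => rx.
have /Cx[u [/= Cu ux]] : nbhs x [set u | `|u - x| < `|restr M x| - r].
  by apply/nbhs_distP; exists (`|restr M x| - r); rewrite ?subr_gt0.
have := norm_restr_dist x u; rewrite ler_norml => /andP[+ _].
by move: Cu ux; rewrite /cylinder /=; lra.
Qed.

Lemma boundary_cylinder : boundary C = [set x | `|restr M x| = r].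
Proof.
rewrite /boundary closure_cylinder; apply/seteqP; split => x /=.
  move=> [Cx nCx]; apply/eqP; rewrite eq_le [X in X && _]Cx /= leNgt.
  by apply/negP => /interior_cylinderP.
by move=> xr; split; [rewrite /cylinder /= xr|
  move/interior_cylinderP; rewrite xr ltxx].
Qed.

Definition radial u : lp p1 :=
  restr (~` M) u + (r / `|restr M u|) *: restr M u.

Lemma radial_sub u :
  u - radial u = (1 - r / `|restr M u|) *: restr M u.
Proof.
rewrite /radial scalerBl scale1r opprD addrA; congr (_ - _).
by rewrite {1}(restr_split M u) addrK.
Qed.

Lemma norm_radial_sub u : r < `|restr M u| ->
  `|u - radial u| = `|restr M u| - r.
Proof.
move=> ru; have N0 := lt_trans r0 ru.
rewrite radial_sub normrZ ger0_norm ?mulrBl ?mul1r ?divfK ?gt_eqF//.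
by rewrite subr_ge0 ler_pdivrMr// mul1r ltW.
Qed.

Lemma radial_cylinder u : r < `|restr M u| -> C (radial u).
Proof.
move=> ru; have N0 := lt_trans r0 ru.
rewrite /cylinder /= /radial restrD restrCr add0r restrZ restr_id normrZ.
by rewrite gtr0_norm ?divr_gt0// divfK// gt_eqF.
Qed.

(* Variational inequality: mazur (u - radial u) is a nonnegative multiple of
   mazur (u_M), so it pairs with y in C to at most its value at radial u. *)
Lemma radial_sub_variational u y : r < `|restr M u| -> C y ->
  `|u - radial u| `^ p <=
  pairing (mazur q1 pq (u - radial u)) (u - y).
Proof.
move=> ru Cy; have N0 := lt_trans r0 ru.
have pB0 : 0 < p - 1 by rewrite subr_gt0.
have l0 : 0 < 1 - r / `|restr M u|.
  by rewrite subr_gt0 ltr_pdivrMr// mul1r.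
rewrite -(mulr_powRB1 (normr_ge0 _) (lt_trans ltr01 p1)) mulrC.
rewrite {2}(norm_radial_sub ru) {1 2}radial_sub mazurZ (pairingZl pq).
(* Cancelling l^(p-1), where l = 1 - r / |u_M|, leaves |u_M|^(p-1) (|u_M| - r) <= <mazur u_M, u -
   y>, which follows from Hoelder and |y_M| <= r. *)
rewrite normrZ powRM// /spow gtr0_sg// mulr1 -mulrA ler_pM2l; last first.
  by rewrite powR_gt0// normr_gt0 gt_eqF.
have -> : mazur q1 pq (restr M u) = restr M (mazur q1 pq (restr M u)).
  by rewrite -mazur_restr restr_id.
rewrite pairing_restr restrB (pairingBr pq).
rewrite pairing_mazur.
apply: (@le_trans _ _ (`|restr M u| `^ p -
    `|mazur q1 pq (restr M u)| * `|restr M y|)); last first.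
  by rewrite lerD2l lerN2 (pairing_le pq).
rewrite norm_mazur -(mulr_powRB1 (normr_ge0 (restr M u)) (lt_trans ltr01 p1)).
set a := _ `^ (p - 1); rewrite -subr_ge0.
rewrite (_ : _ - _ = a * (r - `|restr M y|)); last by ring.
by rewrite mulr_ge0 ?powR_ge0// subr_ge0.
Qed.

Lemma radial_nearest u y : r < `|restr M u| -> C y ->
  `|u - radial u| <= `|u - y|.
Proof.
move=> ru Cy; have := radial_sub_variational ru Cy.
have a0 : 0 < `|u - radial u| by rewrite norm_radial_sub// subr_gt0.
move=> /le_trans/(_ (pairing_le pq _ _)); rewrite norm_mazur.
rewrite -(mulr_powRB1 (normr_ge0 _) (lt_trans ltr01 p1)) mulrC.
by rewrite ler_pM2l// powR_gt0.
Qed.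

(** A competing nearest point y has |u - y| <= |u - radial u|; with the variational inequality,
    [pairing_mazur_eq] then forces u - y = u - radial u. *)
Lemma metric_proj_radial u : r < `|restr M u| -> P u = radial u.
Proof.
move=> ru; apply: xget_unique => [|y [Cy yu]].
  by split; [exact: radial_cylinder|move=> z; exact: radial_nearest].
have := pairing_mazur_eq (yu _ (radial_cylinder ru))
  (radial_sub_variational ru Cy).
by move/addrI/oppr_inj.
Qed.

Lemma metric_proj_cylinderP u :
  C (P u) /\ forall y, C y -> `|u - P u| <= `|u - y|.
Proof.
have [Cu|ru] := leP `|restr M u| r.
  by rewrite metric_proj_id//; split=> // y _; rewrite subrr normr0.
rewrite metric_proj_radial//; split; first exact: radial_cylinder.
by move=> y; exact: radial_nearest.
Qed.

(** The expansion of r / |u_M| comes from the derivative of the norm at x_M. The remainder consists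
    of second-order terms and that of the norm. *)
Lemma radial_differentiable x e : r < `|restr M x| -> 0 < e ->
  exists2 d, 0 < d & forall h, `|h| < d ->
    `|P (x + h) - P x - (restr (~` M) h + (r / `|restr M x|) *:
       (restr M h - (pairing (J (restr M x)) h / `|restr M x| ^+ 2)
          *: restr M x))| <= e * `|h|.
Proof.
move=> rx e0; set N := `|restr M x|; have N0 : 0 < N := lt_trans r0 rx.
have e20 : 0 < e / 2 by rewrite divr_gt0.
have x0 : restr M x != 0 by rewrite -normr_gt0.
have [d d0 xd] := lp_norm_differentiable q1 pq x0 e20.
(* N - r keeps x + h outside the cylinder; e N / 4 makes the second-order total 2 |h|^2 / N at most
   e |h| / 2. *)
exists (Num.min d (Num.min (N - r) (e * N / 4))).
  by rewrite !lt_min d0 subr_gt0 rx !divr_gt0// mulr_gt0.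
move=> h; rewrite !lt_min => /and3P[hd hr he].
have hM : `|restr M h| <= `|h| by exact: norm_restr_le.
have := xd _ (le_lt_trans hM hd); rewrite -restrD -/N.
set Nu := `|restr M (x + h)|.
rewrite -pairing_restr restr_duality_map.
set l := pairing (J (restr M x)) h => rho.
have {}rho : `|Nu - N - N^-1 * l| <= e / 2 * `|h|.
  by rewrite (le_trans rho)// ler_pM2l.
have dN : `|Nu - N| <= `|h|.
  by have := norm_restr_dist x (x + h); rewrite [x + h - x]addrAC subrr add0r.
have ru : r < Nu by move: dN hr; rewrite ler_norml => /andP[+ _]; lra.
have Nu0 := lt_trans r0 ru.
rewrite !metric_proj_radial// /radial -/N -/Nu.
have -> : restr (~` M) (x + h) + (r / Nu) *: restr M (x + h) -
    (restr (~` M) x + (r / N) *: restr M x) -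
    (restr (~` M) h + (r / N) *: (restr M h - (l / N ^+ 2) *: restr M x)) =
    (r / Nu - r / N + r / N * (l / N ^+ 2)) *: restr M x +
    (r / Nu - r / N) *: restr M h.
  apply/lpP => k; rewrite !restrD !(lpDE, lpNE, lpZE).
  set x1 := restr M x k; set h1 := restr M h k.
  set x2 := restr (~` M) x k; set h2 := restr (~` M) h k.
  by ring.
have contract (a b c : R) : 0 < a -> a <= 1 -> `|b| <= c -> `|a * b| <= c.
  move=> a0 a1 bc; rewrite normrM gtr0_norm// (le_trans _ bc)//.
  by rewrite ler_piMl.
have rNu0 : 0 < r / Nu by rewrite divr_gt0.
have rNu1 : r / Nu <= 1 by rewrite ler_pdivrMr// mul1r ltW.
have rN0 : 0 < r / N by rewrite divr_gt0.
have rN1 : r / N <= 1 by rewrite ler_pdivrMr// mul1r ltW.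
have B1 : `|r / Nu - r / N| <= `|h| / N.
  have -> : r / Nu - r / N = - (r / Nu * ((Nu - N) / N)).
    by field; rewrite !gt_eqF.
  rewrite normrN contract// normrM (gtr0_norm (_ : 0 < N^-1)) ?invr_gt0//.
  by rewrite ler_pM2r ?invr_gt0.
have B2 : `|r / Nu * ((Nu - N) ^+ 2 / N ^+ 2)| <= `|h| ^+ 2 / N ^+ 2.
  have N20 : 0 < (N ^+ 2)^-1 by rewrite invr_gt0 exprn_gt0.
  rewrite contract// normrM (gtr0_norm N20) ler_pM2r// normrX.
  by rewrite lerXn2r ?nnegrE.
have B3 : `|r / N * ((Nu - N - N^-1 * l) / N)| <= e / 2 * `|h| / N.
  rewrite contract// normrM (gtr0_norm (_ : 0 < N^-1)) ?invr_gt0//.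
  by rewrite ler_pM2r ?invr_gt0.
have B4 : `|r / Nu - r / N + r / N * (l / N ^+ 2)| <=
    `|h| ^+ 2 / N ^+ 2 + e / 2 * `|h| / N.
  have -> : r / Nu - r / N + r / N * (l / N ^+ 2) =
      r / Nu * ((Nu - N) ^+ 2 / N ^+ 2) - r / N * ((Nu - N - N^-1 * l) / N).
    by field; rewrite !gt_eqF.
  by rewrite (le_trans (ler_normB _ _))// lerD.
rewrite (le_trans (ler_normD _ _))// !normrZ -/N.
apply: (@le_trans _ _ ((`|h| ^+ 2 / N ^+ 2 + e / 2 * `|h| / N) * N +
    `|h| / N * `|h|)).
  by apply: lerD; [apply: ler_wpM2r => //; exact: ltW|apply: ler_pM].
have -> : (`|h| ^+ 2 / N ^+ 2 + e / 2 * `|h| / N) * N + `|h| / N * `|h| =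
    `|h| * (e / 2 + 2 * (`|h| / N)) by field; rewrite gt_eqF.
rewrite mulrC ler_wpM2r//.
have : `|h| / N <= e / 4 by rewrite ler_pdivrMr// mulrAC ltW.
lra.
Qed.

(** * Coderivatives of the projection *)

Local Notation D := (frechet_coderivative P : lp p1 -> lp q1 -> set (lp q1)).
Implicit Types (y z : lp q1) (w : lp p1).

(** [mazur] commutes with restriction, so only the norm factors differ. *)
Lemma restr_duality_mapZ x : restr M x != 0 ->
  exists2 c : R, 0 < c & restr M (J x) = c *: J (restr M x).
Proof.
move=> xM0; have x0 : x != 0.
  by apply: contraNneq xM0 => ->; rewrite restr0.
exists ((`|x| `^ (p - 2))^-1 * `|restr M x| `^ (p - 2)).
  by rewrite mulr_gt0// ?invr_gt0 powR_gt0// normr_gt0.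
rewrite !duality_mapE restrZ mazur_restr scalerA mulfK// gt_eqF//.
by rewrite powR_gt0// normr_gt0.
Qed.

Lemma pairing_restr_restr y x :
  pairing (restr M y) (restr M x) = pairing (restr M y) x.
Proof. by rewrite -pairing_restr restr_id. Qed.

Lemma cylinder_convex x w (t : R) : 0 <= t <= 1 ->
  C x -> C w -> C (x + t *: (w - x)).
Proof.
rewrite /cylinder /= => /andP[t0 t1] Cx Cw.
have -> : x + t *: (w - x) = (1 - t) *: x + t *: w.
  by rewrite scalerBr scalerBl scale1r addrA addrAC.
rewrite restrD !restrZ (le_trans (ler_normD _ _))// !normrZ.
rewrite (ger0_norm t0) ger0_norm ?subr_ge0//.
have := ler_wpM2l t0 Cw.
have t'0 : 0 <= 1 - t by rewrite subr_ge0.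
have := ler_wpM2l t'0 Cx.
lra.
Qed.

(** By convexity the projection fixes the segment from x to w, so its increments along this ray are
    t (w - x). *)
Lemma coderivative_proj_feasible x w y z : C x -> C w -> D x y z ->
  pairing z (w - x) <= pairing y (w - x).
Proof.
move=> Cx Cw Dz.
apply: (frechet_coderivative_ray pq (K := `|w - x|) Dz) => e e0.
exists 1 => // t /andP[t0 t1].
have Ct : C (x + t *: (w - x)) by apply: cylinder_convex; rewrite ?ltW.
rewrite !metric_proj_id// addrAC subrr add0r normrZ gtr0_norm//.
by rewrite (pairingZr pq) ler_pM2l// lerDl ltW.
Qed.

(** Conversely the numerator for z = 0 is - <y, P u - x>, which is nonpositive because P u lies in
    C. *)
Lemma coderivative_proj_mem0P x y : C x ->
  D x y 0 <-> forall w, C w -> 0 <= pairing y (w - x).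
Proof.
move=> Cx; split => [D0 w Cw|ymin].
  by rewrite -(pairing0l q1 pq (w - x)) (coderivative_proj_feasible Cx).
apply/frechet_coderivativeP => // e e0; exists 1 => // u _.
rewrite (pairing0l q1 pq) sub0r (metric_proj_id Cx).
rewrite (@le_trans _ _ 0)// ?oppr_le0; last by rewrite mulr_ge0 ?addr_ge0// ltW.
by apply: ymin; case: (metric_proj_cylinderP u).
Qed.

(** C is unbounded in the coordinates off M, so y is bounded below on C only if it vanishes there;
    its minimum over C is then - r |y_M|. *)
Lemma coderivative_proj_mem0_boundaryP x y : `|restr M x| = r ->
  D x y 0 <-> restr (~` M) y = 0 /\
    pairing (restr M y) (restr M x) = - (r * `|restr M y|).
Proof.
move=> xr; have Cx : C x by rewrite /cylinder /= xr.
pose J' := duality_map p1 (conjugate_sym pq) : lp q1 -> lp p1.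
have J'E A : pairing y (J' (restr A y)) = `|restr A y| ^+ 2.
  rewrite /J' -restr_duality_map -pairing_restr.
  by rewrite -pairingC pairing_duality_map.
rewrite (coderivative_proj_mem0P _ Cx).
split => [ymin|[yc yM] w Cw].
  have yc : restr (~` M) y = 0.
    have : C (x - J' (restr (~` M) y)).
      rewrite /cylinder /= restrB /J' -restr_duality_map restrCr subr0.
      by rewrite xr.
    move=> /ymin; rewrite addrAC subrr add0r (pairingNr pq) J'E oppr_ge0 => yc0.
    by apply/eqP; rewrite -normr_eq0 -sqrf_eq0 eq_le yc0 sqr_ge0.
  split=> //; apply/eqP; rewrite eq_le; apply/andP; split; last first.
    rewrite lerNl -(pairingNl pq) -xr mulrC -normrN.
    by rewrite (le_trans (pairing_le pq _ _))// normrN.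
  rewrite pairing_restr_restr.
  have yE : y = restr M y by rewrite {1}(restr_split M y) yc addr0.
  have [y0|y0] := eqVneq (restr M y) 0.
    by rewrite y0 normr0 mulr0 oppr0 (pairing0l q1 pq).
  have Ny0 : 0 < `|restr M y| by rewrite normr_gt0.
  (* This point attains the minimum: J* gives equality in Hoelder's inequality. *)
  have : C (- (r / `|restr M y|) *: J' (restr M y)).
    rewrite /cylinder /= (le_trans (norm_restr_le _ _))// normrZ normrN.
    by rewrite norm_duality_map gtr0_norm ?divr_gt0// divfK// gt_eqF.
  move=> /ymin; rewrite (pairingBr pq) subr_ge0 (pairingZr pq) J'E.
  by rewrite mulNr expr2 mulrA divfK ?gt_eqF// -yE.
have yE : y = restr M y by rewrite {1}(restr_split M y) yc addr0.
rewrite (pairingBr pq) yE -(pairing_restr_restr y x) yM opprK.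
rewrite -pairing_restr_restr -lerBlDr sub0r lerNl -(pairingNl pq).
by rewrite (le_trans (pairing_le pq _ _))// normrN mulrC ler_wpM2r.
Qed.

(** A short step from x along - J* y would stay in C and change y by a negative multiple of |y|^2,
    against minimality at x. *)
Lemma down_directions_duality_map x y : `|restr M x| = r -> y != 0 ->
  restr (~` M) y = 0 ->
  pairing (restr M y) (restr M x) = - (r * `|restr M y|) ->
  ~ down_directions M r x
      (- restr M (duality_map p1 (conjugate_sym pq) y)).
Proof.
move=> xr y0 yc yM [d d0 dC].
have Cx : C x by rewrite /cylinder /= xr.
have ymin := (coderivative_proj_mem0P _ Cx).1
  ((coderivative_proj_mem0_boundaryP y xr).2 (conj yc yM)).
have yE : y = restr M y by rewrite {1}(restr_split M y) yc addr0.
have d20 : 0 < d / 2 by rewrite divr_gt0.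
have /ymin : C (x + (d / 2) *: - restr M (duality_map p1 (conjugate_sym pq) y)).
  by apply: dC; rewrite d20 /= ltr_pdivrMr// ltr_pMr// ltr1n.
rewrite addrAC subrr add0r (pairingZr pq) (pairingNr pq) -pairing_restr -yE.
rewrite -pairingC pairing_duality_map mulrN oppr_ge0 leNgt => /negP; apply.
by rewrite mulr_gt0// exprn_gt0// normr_gt0.
Qed.

(** With y = 0 a ray requires only a bound on the increment of P. As x itself competes for the
    nearest point, |P u - x| <= 2 |u - x|. *)
Lemma coderivative_proj0 x : C x -> D x 0 = [set 0].
Proof.
move=> Cx; apply/seteqP; split => [z Dz|_ ->] /=; last first.
  by apply/coderivative_proj_mem0P => // w _; rewrite (pairing0l q1 pq).
apply: (pairing_le0_eq0 pq) => v.
apply: (frechet_coderivative_ray pq (K := 2 * `|v|) Dz) => e e0.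
exists 1 => // t /andP[t0 _]; rewrite (pairing0l q1 pq) add0r.
split; first by rewrite mulr_ge0 ?ltW.
rewrite (metric_proj_id Cx).
have uE : `|x + t *: v - x| = t * `|v|.
  by rewrite addrAC subrr add0r normrZ gtr0_norm.
have [_ /(_ _ Cx)] := metric_proj_cylinderP (x + t *: v).
rewrite uE => uP.
rewrite -(subrKA (x + t *: v)) (le_trans (ler_normD _ _))// uE distrC.
by rewrite mulrCA mulr_natl mulr2n lerD.
Qed.

Lemma coderivative_proj_duality_map x : `|restr M x| = r -> D x (J x) = set0.
Proof.
move=> xr; have Cx : C x by rewrite /cylinder /= xr.
have xM0 : restr M x != 0 by rewrite -normr_gt0 xr.
have [c c0 cJ] := restr_duality_mapZ xM0.
apply/seteqP; split => // z Dz.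
(* The projection sends the whole outward ray x + t x_M back to x, so y contributes nothing and K =
   0 suffices. *)
have : pairing z (restr M x) <= 0.
  apply: (frechet_coderivative_ray pq (K := 0) Dz) => e e0.
  exists 1 => // t /andP[t0 _].
  have t10 : 0 < 1 + t by rewrite addr_gt0.
  have xtE : restr M (x + t *: restr M x) = (1 + t) *: restr M x.
    by rewrite restrD restrZ restr_id scalerDl scale1r.
  have xtN : `|restr M (x + t *: restr M x)| = (1 + t) * r.
    by rewrite xtE normrZ gtr0_norm// xr.
  rewrite metric_proj_radial; last by rewrite xtN ltr_pMl// ltrDl.
  rewrite (metric_proj_id Cx) /radial xtN xtE scalerA.
  rewrite restrD restrZ restrCl scaler0 addr0.
  have -> : r / ((1 + t) * r) * (1 + t) = 1 by field; rewrite !gt_eqF.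
  rewrite scale1r [_ + restr M x]addrC -restr_split subrr (pairing0r p1 pq).
  by rewrite normr0 add0r mulr0 mulr_ge0// ltW.
(* The inward direction - x_M gives <J x, x_M> <= <z, x_M>, where the left side is c r^2 > 0. *)
have Cw : C (x - restr M x).
  by rewrite /cylinder /= restrB restr_id subrr normr0 ltW.
have := coderivative_proj_feasible Cx Cw Dz.
rewrite addrAC subrr add0r !(pairingNr pq) lerN2 => le1 le2.
have := le_trans le1 le2; rewrite -[restr M x]restr_id -pairing_restr cJ.
rewrite (pairingZl pq) pairing_duality_map leNgt => /negP[].
by rewrite mulr_gt0// exprn_gt0// xr.
Qed.

(** The projection is the identity near x. *)
Lemma coderivative_proj_interior x y : C° x -> D x y = [set y].
Proof.
move=> /interior_cylinderP xr.
apply: (frechet_coderivative_differentiable pq (A := id)) => // e e0.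
exists (r - `|restr M x|); first by rewrite subr_gt0.
move=> h hr; rewrite !metric_proj_id.
- by rewrite [x + h]addrC addrK subrr normr0 mulr_ge0// ltW.
- exact: ltW.
rewrite /cylinder /= restrD (le_trans (ler_normD _ _))//.
have := norm_restr_le M h; lra.
Qed.

(** The adjoint of the derivative found above: the rank-one term h |-> <J x_M, h> x_M becomes y |->
    <y, x_M> J x_M. *)
Lemma coderivative_proj_exterior x y : ~ C x -> D x y =
  [set (r / `|restr M x|) *:
         (restr M y
          - (pairing (restr M y) (restr M x) / `|restr M x| ^+ 2)
              *: J (restr M x))
       + restr (~` M) y].
Proof.
move=> /negP; rewrite -ltNge => rx.
apply: (frechet_coderivative_differentiable pq (A := fun h =>
    restr (~` M) h + (r / `|restr M x|) *:
       (restr M h - (pairing (J (restr M x)) h / `|restr M x| ^+ 2)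
          *: restr M x))).
- move=> t v; rewrite !restrZ (pairingZr pq) [RHS]scalerDr; congr (_ + _).
  rewrite -[t * _ / _]mulrA.
  move: (r / _) (pairing _ v / _) => a b.
  move: (restr M v) (restr M x) => v' x'.
  by apply/lpP => k; rewrite !(lpDE, lpNE, lpZE); ring.
- by move=> e e0; exact: radial_differentiable.
move=> h.
rewrite (pairingDr pq) (pairingZr pq) (pairingBr pq) (pairingZr pq).
rewrite (pairingDl pq) (pairingZl pq) (pairingBl pq) (pairingZl pq).
rewrite pairing_restr_restr !pairing_restr.
move: (pairing _ (restr _ h)) (pairing _ (restr _ x)) (pairing _ h) => a b c.
by ring.
Qed.

(** The M-part of J x is a multiple of J (x_M), which the first term annihilates because <J x_M,
    x_M> = |x_M|^2. *)
Lemma coderivative_proj_exterior_duality_map x : ~ C x ->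
  D x (J x) = [set restr (~` M) (J x)].
Proof.
move=> nCx; have rx : r < `|restr M x| by rewrite ltNge; apply/negP.
have N0 := lt_trans r0 rx.
have xM0 : restr M x != 0 by rewrite -normr_gt0.
have [c c0 cJ] := restr_duality_mapZ xM0.
rewrite coderivative_proj_exterior// cJ (pairingZl pq) pairing_duality_map.
by rewrite mulfK ?expf_neq0 ?gt_eqF// subrr scaler0 add0r.
Qed.

End cylinder_projection.

(** * The cases of interior, exterior and boundary points together *)

Theorem theorem4p1 (R : realType) (p q : R) (p1 : 1 < p) (q1 : 1 < q)
    (pq : p^-1 + q^-1 = 1) (M : set nat) (M0 : M !=set0)
    (r : R) (r0 : 0 < r) :
  let J : lp p1 -> lp q1 := duality_map q1 pq in
  let J' : lp q1 -> lp p1 := duality_map p1 (conjugate_sym pq) in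
  let C : set (lp p1) := cylinder M r in
  let D : lp p1 -> lp q1 -> set (lp q1) :=
    frechet_coderivative (metric_proj C) in
  (forall x, C° x -> forall y, D x y = [set y])
  /\
  ((forall x, ~ C x -> forall y,
      D x y =
      [set (r / `|restr M x|) *:
             (restr M y
              - (pairing (restr M y) (restr M x) / `|restr M x| ^+ 2)
                  *: J (restr M x))
           + restr (~` M) y])
   /\ (forall x, ~ C x -> D x (J x) = [set restr (~` M) (J x)]))
  /\
  (boundary C = [set x | `|restr M x| = r]
   /\ forall x, boundary C x ->
     (D x 0 = [set 0])
     /\ ((forall y, y <> 0 ->
            (D x y 0 <->
             [/\ restr (~` M) y = 0,
                 ~ down_directions M r x (- restr M (J' y)) &
                 pairing (restr M y) (restr M x) = - (r * `|restr M y|)]))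
         /\ D x (- restr M (J x)) 0)
     /\ D x (J x) = set0).
Proof.
move=> J J' C D; split; [|split; split].
- by move=> x Cx y; exact: coderivative_proj_interior.
- by move=> x nCx y; exact: coderivative_proj_exterior.
- by move=> x nCx; exact: coderivative_proj_exterior_duality_map.
- exact: boundary_cylinder.
move=> x; rewrite /C boundary_cylinder// => xr.
have Cx : C x by rewrite /C /cylinder /= xr.
split; first exact: coderivative_proj0.
split; last exact: coderivative_proj_duality_map.
split=> [y /eqP y0|].
  split=> [/(coderivative_proj_mem0_boundaryP pq r0 y xr)[yc yM]|[yc _ yM]].
    by split=> //; exact: down_directions_duality_map.
  exact/(coderivative_proj_mem0_boundaryP pq r0 y xr).
have xM0 : restr M x != 0 by rewrite -normr_gt0 xr.
(* Here y = - c J (x_M) has norm c r and <y, x_M> = - c r^2, the equality case of Hoelder's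
   inequality. *)
have [c c0 cJ] := restr_duality_mapZ q1 pq xM0.
apply/(coderivative_proj_mem0_boundaryP pq r0 _ xr).
rewrite !restrN restr_id restrCl oppr0 cJ normrN normrZ gtr0_norm//.
rewrite (pairingNl pq) (pairingZl pq) pairing_duality_map norm_duality_map xr.
by split=> //; congr (- _); ring.
Qed.
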